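(* Let $\mathbf{G}$ be a countably infinite undirected graph such that each vertex has finite degree, there is at most one edge between any two vertices, and a vertex can be connected to itself. Let $(v_i)_{i\in\mathbb{N}}$ be an enumeration of the vertices of $\mathbf{G}$ and let $(v_{i_1},v_{i_2},v_{i_3},\ldots)$ be the vertices connected to themselves. Each vertex carries a light which is either on or off, and clicking a vertex switches the state of every vertex adjacent to it (including itself if and only if it is connected to itself). Then, starting with all the lights off, it is possible, by clicking on a (possibly infinite) set of vertices, to turn on only the lights of $(v_{i_1},v_{i_2},v_{i_3},\ldots)$; that is, there is a set of vertices such that after clicking its members, the lights that are on are precisely those of the vertices connected to themselves.
   Context: A vertex is ''connected to itself'' if the graph has a loop at that vertex; such a vertex is counted as adjacent to itself, and a vertex without a loop is not adjacent to itself. The effect of clicking a (possibly infinite) set $S$ of vertices, starting with all lights off, is as follows: since every vertex has finite degree, each vertex $v$ is adjacent to only finitely many vertices of $S$, so its state is switched only finitely many times, and its final state is on if and only if the number of vertices of $S$ adjacent to $v$ (counting $v$ itself if $v\in S$ and $v$ is connected to itself) is odd. The family of vertices connected to themselves may be finite (or empty) or infinite. *)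

(* Defs.v *)
From mathcomp Require Import all_boot.
From mathcomp Require Import boolp classical_sets functions cardinality.

Set Implicit Arguments.
Unset Strict Implicit.
Unset Printing Implicit Defensive.

Local Open Scope classical_set_scope.

(* A graph on [V] is given by its adjacency relation [adj : V -> V -> Prop]
   (so there is at most one edge between two vertices); [adj x x] says that
   there is a loop at [x]. *)

Definition undirected (V : Type) (adj : V -> V -> Prop) : Prop :=
  forall x y, adj x y -> adj y x.

(* [x] belongs to its own neighbourhood exactly when it carries a loop. *)
Definition neighbours (V : Type) (adj : V -> V -> Prop) (x : V) : set V :=
  [set y | adj x y].

Definition locally_finite (V : Type) (adj : V -> V -> Prop) : Prop :=
  forall x, finite_set (neighbours adj x).

Definition self_connected (V : Type) (adj : V -> V -> Prop) : set V :=
  [set x | adj x x].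

(* The lights that are on after clicking the members of [S], all lights being
   initially off: those of the vertices [x] that are switched an odd number [n]
   of times. When [adj] is locally finite, the number [n] of clicked neighbours
   of [x] exists and is unique. *)
Definition lights_on (V : Type) (adj : V -> V -> Prop) (S : set V) : set V :=
  [set x | exists2 n : nat, (S `&` neighbours adj x #= `I_n)%card & odd n].

(* Main.v *)
Require Import Defs.
From mathcomp Require Import all_boot.
From mathcomp Require Import all_algebra finmap.
From mathcomp Require Import boolp classical_sets functions cardinality filter.

Local Open Scope classical_set_scope.

Import GRing.Theory.

(** Over the field with two elements, clicking the set with indicator vector
    [s] lights up [A s], where [A] is the adjacency matrix, and the goal is
    that [A s] be the diagonal of [A].

    For a finite symmetric matrix this system is solvable: if [A c = 0] then
    [c^T A c = 0]; in characteristic 2 the off-diagonal terms of this quadratic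
    form cancel in pairs and [c_i ^ 2 = c_i], so the form is the pairing of the
    diagonal of [A] with [c]. The diagonal is thus orthogonal to the kernel of
    [A], hence lies in its row space ([diag_sub_sym]).

    For the infinite graph, number the vertices. Given [n], take a finite
    induced subgraph containing the first [n] vertices and all their
    neighbours: the finite case gives a set of clicks that is correct at the
    first [n] vertices ([click_finite]). A limit of these sets along an
    ultrafilter is correct everywhere, because the light of a vertex depends
    only on its finitely many neighbours ([click_all]).

    Throughout, the field with two elements is [bool], whose addition is
    exclusive or and whose multiplication is conjunction. *)

(** The terms at [(i, j)] and [(j, i)] are equal, hence cancel when
    [i != j]. *)
Lemma sum_sym_bool (n : nat) (f : 'I_n -> 'I_n -> bool) :
  (forall i j, f i j = f j i) ->
  (\sum_i \sum_j f i j = \sum_i f i i)%R.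
Proof.
move=> fC.
pose below := (\sum_(i < n) \sum_(j < n | (j < i)%N) f i j)%R.
have above : (\sum_(i < n) \sum_(j < n | (i < j)%N) f i j = below)%R.
  rewrite (exchange_big_dep xpredT) //=.
  by apply: eq_bigr => i _; apply: eq_bigr => j _; exact: fC.
transitivity ((\sum_i f i i) + (below + below))%R; last first.
  by rewrite [(below + below)%R]addbb addr0.
rewrite -{1}above -!big_split /=; apply: eq_bigr => i _.
rewrite (bigD1 i) //=; congr (_ + _)%R.
rewrite (bigID (fun j : 'I_n => (i < j)%N)) /=.
by congr (_ + _)%R; apply: eq_bigl => j; rewrite -val_eqE /=; case: ltngtP.
Qed.

(** A row vector is in the row space of [A] as soon as it annihilates the
    columns [c] of [cokermx A], for which [A c = 0]; and the diagonal of [A]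
    pairs with [c] to [c^T A c = 0]. *)
Lemma diag_sub_sym (n : nat) (A : 'M[bool]_n) :
  (forall i j, A i j = A j i) -> ((\row_i A i i)%R <= A)%MS.
Proof.
move=> AC; rewrite submxE; apply/eqP/rowP => k; rewrite mxE [RHS]mxE.
set c := cokermx A.
have Ac i : (\sum_j A i j * c j k = 0)%R.
  by have /matrixP/(_ i k) := mulmx_coker A; rewrite mxE [RHS]mxE.
transitivity (\sum_i \sum_j c i k * (A i j * c j k))%R.
  rewrite sum_sym_bool => [|i j].
    (* the squares [c i k * c i k] are absorbed by idempotence of [bool] *)
    by apply: eq_bigr => i _; rewrite mxE mulrCA; congr (_ * _)%R; case: (c i k).
  by rewrite AC mulrCA [RHS]mulrCA [(c i k * _)%R]mulrC.
by apply: big1 => i _; rewrite -mulr_sumr Ac mulr0.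
Qed.

(** Compactness of the set of functions [T -> bool] for pointwise convergence:
    along an ultrafilter, each coordinate is eventually constant. *)
Lemma ultralimit_bool (T I : Type) (U : set_system I) (b : I -> T -> bool) :
  UltraFilter U ->
  exists l : T -> bool, forall t, U [set i : I | b i t = l t].
Proof.
move=> Uultra; exists (fun t => `[< U [set i | b i t] >]) => t.
case: asboolP => // NUb; have [//|] := in_ultra_setVsetC [set i | b i t] Uultra.
by apply: filterS => i /= /negP/negbTE.
Qed.

Lemma odd_card_trueset (N n : nat) (p : pred nat) :
  (forall j, p j -> (j < N)%N) ->
  ([set j | p j] #= `I_n)%card -> odd n = (\sum_(j < N) p j)%R.
Proof.
move=> pN.
set s := [seq j <- iota 0 N | p j].
have -> : [set j | p j] = [set` seq_fset tt s].
  apply/seteqP; split => j /=; rewrite (seq_fsetE tt s) mem_filter mem_iota.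
    by move=> pj; rewrite pj pN.
  by case/andP.
move=> /card_eq_fsetP <-.
rewrite size_seq_fset undup_id ?filter_uniq ?iota_uniq // size_filter.
rewrite -sum1_count big_mkcond /=.
rewrite -[N in iota _ N]subn0 -/(index_iota 0 N) big_mkord.
rewrite (big_morph odd oddD (erefl _)).
by apply: eq_bigr => j _; case: (p j).
Qed.

Lemma finite_nat_bounded (A : set nat) :
  finite_set A -> exists N, forall j, A j -> (j < N)%N.
Proof.
move=> /finite_seqP[s ->]; exists (\max_(j <- s) j).+1 => j /= sj.
by rewrite ltnS leq_bigmax_seq.
Qed.

(** The light of vertex [i] in a graph [a] on [nat], after clicking [b]. The
    number [N i] is to bound the neighbours of [i], so that the sum is the
    parity of all its clicked neighbours. *)
Definition light (a : nat -> nat -> bool) (N : nat -> nat) (b : nat -> bool)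
    (i : nat) : bool :=
  (\sum_(j < N i) (b j && a i j))%R.

(** The vertices below [n] and their neighbours all lie below some [M]: it is
    enough to solve the finite problem on the subgraph induced by the vertices
    up to [M], where the lights below [n] are those of the whole graph. *)
Lemma click_finite (a : nat -> nat -> bool) (N : nat -> nat) (n : nat) :
  (forall i j, a i j = a j i) -> (forall i j, a i j -> (j < N i)%N) ->
  exists b, forall i, (i < n)%N -> light a N b i = a i i.
Proof.
move=> aC aN; pose M := (n + \max_(i < n) N i)%N.
pose A : 'M[bool]_M.+1 := (\matrix_(i, j) a i j)%R.
have /submxP[u uA] : ((\row_i A i i)%R <= A)%MS.
  by apply: diag_sub_sym => i j; rewrite !mxE.
(* Beyond [M], [inord] yields an arbitrary value, but such vertices are not
   adjacent to any vertex below [n]. *)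
exists (fun j => u ord0 (inord j)) => i ltin.
have iM : (i < M.+1)%N by rewrite ltnS ltnW // ltn_addr.
have NM : (N i <= M.+1)%N.
  apply/leqW/(leq_trans _ (leq_addl _ _)).
  exact: (leq_bigmax (F := fun i : 'I_n => N i) (Ordinal ltin)).
have /rowP/(_ (Ordinal iM)) := uA; rewrite !mxE /= => ->.
rewrite /light (big_ord_widen _ (fun j => u ord0 (inord j) && a i j) NM).
rewrite big_mkcond /=; apply: eq_bigr => j _; rewrite inord_val mxE (aC j).
case: ifPn => // /negP jN; rewrite (_ : a i j = false) ?mulr0 //.
by apply/negP => /aN.
Qed.

(** The light of [i] under the ultralimit of the partial solutions agrees with
    its light under one of them that is already correct at [i]: finitely many
    coordinates matter, and on these the [n]-th partial solution agrees with
    the limit for ultrafilter-many [n]. *)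
Lemma click_all (a : nat -> nat -> bool) (N : nat -> nat) :
  (forall i j, a i j = a j i) -> (forall i j, a i j -> (j < N i)%N) ->
  exists b, forall i, light a N b i = a i i.
Proof.
move=> aC aN; have [b bP] := choice (fun n => @click_finite a N n aC aN).
have [U [Uultra leU]] := ultraFilterLemma eventually_filter.
have [l lP] := ultralimit_bool _ _ U b Uultra.
exists l => i.
have Ul : U [set n | forall j, (j < N i)%N -> b n j = l j].
  elim: (N i) => [|k IHk]; first by apply: filterS filterT.
  apply: filterS2 IHk (lP k) => n bl blk j; rewrite ltnS leq_eqVlt.
  by case/orP => [/eqP->|/bl].
have Ui : U [set n | (i < n)%N] by apply: leU; exists i.+1.
have [n [/= bl ltin]] := filter_ex (filterI Ul Ui).
by rewrite -(bP n i ltin); apply: eq_bigr => j _; rewrite bl.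
Qed.

Theorem corollary3p2 (V : Type) (adj : V -> V -> Prop)
    (adj_sym : undirected adj) (adj_fin : locally_finite adj)
    (v : nat -> V) (v_enum : bijective v) :
  exists S : set V, lights_on adj S = self_connected adj.
Proof.
have [v' vK v'K] := v_enum.
have v_inj : injective v := can_inj vK.
pose a i j := `[< adj (v i) (v j) >].
have aC i j : a i j = a j i by apply: asbool_equiv_eq; split; exact: adj_sym.
have /choice[N aN] : forall i, exists N, forall j, a i j -> (j < N)%N.
  move=> i; apply: finite_nat_bounded.
  apply: sub_finite_set (finite_image v' (adj_fin (v i))) => j /asboolP aij.
  by exists (v j).
have [b bP] := click_all a N aC aN.
exists (v @` [set j | b j]).
have clickedE i : v @` [set j | b j] `&` neighbours adj (v i) =
    v @` [set j | b j && a i j].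
  apply/seteqP; split => [_ [[j bj <-] aij]|_ [j /andP[bj /asboolP aij] <-]].
    by exists j => //=; rewrite bj; apply/asboolP.
  by split => //; exists j.
have cardE i n : (v @` [set j | b j] `&` neighbours adj (v i) #= `I_n)%card =
    ([set j | b j && a i j] #= `I_n)%card.
  rewrite clickedE; apply/idP/idP; apply: card_eq_trans.
    by rewrite card_eq_sym; apply: inj_card_eq => ? ? _ _; exact: v_inj.
  by apply: inj_card_eq => ? ? _ _; exact: v_inj.
have oddE i n : ([set j | b j && a i j] #= `I_n)%card -> odd n = a i i.
  move=> /(odd_card_trueset (N i) n _) ->; first exact: bP.
  by move=> j /andP[_ /aN].
apply/seteqP; split => x; rewrite -(v'K x); move: (v' x) => i.
  by case=> n; rewrite cardE => /oddE -> /asboolP.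
move=> aii.
have /finite_setP[n cn] :
    finite_set (v @` [set j | b j] `&` neighbours adj (v i)).
  by apply: sub_finite_set (adj_fin (v i)) => y [].
by exists n => //; rewrite cardE in cn; rewrite (oddE i n cn); apply/asboolP.
Qed.
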